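(* Let $T$ be a canonical theory in a language $\mathcal L$ and let $\mathcal N$ be a weak $T$-on. Then there exists a strong $T$-on $\mathcal N'$ such that $\lambda(\mathcal N_P\triangle\mathcal N'_P)=0$ for every predicate symbol $P\in\mathcal L$.
   Context: A language $\mathcal L$ is a finite set of predicate symbols, each $P$ with an arity $k(P)\ge1$ (no constants or function symbols; equality allowed). A universal theory $T$ is a set of universal formulas (axioms) $\forall\vec x F(\vec x)$, $F$ open. A structure $M$ is a set $V(M)$ with relations $R_{P,M}\subseteq V(M)^{k(P)}$; it is a model of $T$ if all axioms hold. $T$ is canonical if for every $P$ of arity $k$ and $1\le i<j\le k$, $T$ entails $x_i=x_j\to\neg P(x_1,\dots,x_k)$; a structure is canonical if no $R_{P,M}$ contains a tuple with a repeated entry. For a set $V$, $r(V)$ is the set of non-empty finite subsets of $V$, $\mathcal E_V=[0,1]^{r(V)}$ with Lebesgue (product) measure $\lambda$, and $\mathcal E_k=\mathcal E_{[k]}$. For an injection $\alpha:[k]\to V$, $\alpha^*:\mathcal E_V\to\mathcal E_k$ is $\alpha^*(x)_A=x_{\alpha(A)}$. A $P$-on is a Lebesgue measurable subset of $\mathcal E_{k(P)}$; a Euclidean structure $\mathcal N$ assigns to each $P\in\mathcal L$ a $P$-on $\mathcal N_P$. For a finite structure $M$ let $R_P(M)$ (resp. $\overline R_P(M)$) be the set of injections $\alpha:[k(P)]\to V(M)$ with $(\alpha(1),\dots,\alpha(k(P)))\in R_{P,M}$ (resp. $\notin R_{P,M}$), and $T_{\mathrm{ind}}(M,\mathcal N)=\bigcap_{P\in\mathcal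 L}\big(\bigcap_{\alpha\in R_P(M)}(\alpha^* )^{-1}(\mathcal N_P)\cap\bigcap_{\alpha\in\overline R_P(M)}(\alpha^* )^{-1}(\mathcal E_{k(P)}\setminus\mathcal N_P)\big)\subseteq\mathcal E_{V(M)}$, $t_{\mathrm{ind}}(M,\mathcal N)=\lambda(T_{\mathrm{ind}}(M,\mathcal N))$. The diagonal is $\mathcal D_V=\{x\in\mathcal E_V:\exists i\neq j\in V,\ x_{\{i\}}=x_{\{j\}}\}$. A weak $T$-on is a Euclidean structure $\mathcal N$ with $t_{\mathrm{ind}}(M,\mathcal N)=0$ for every finite canonical structure $M$ that is not a model of $T$; a strong $T$-on is one with $T_{\mathrm{ind}}(M,\mathcal N)\subseteq\mathcal D_{V(M)}$ for every such $M$. *)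

(* Defs.v *)
From HB Require Import structures.
From mathcomp Require Import all_boot all_order all_algebra.
From mathcomp Require Import all_classical all_reals all_analysis.

Set Implicit Arguments.
Unset Strict Implicit.
Unset Printing Implicit Defensive.

Import Order.TTheory GRing.Theory Num.Theory.
Import numFieldNormedType.Exports.

Local Open Scope classical_set_scope.
Local Open Scope ring_scope.

Record language := Language {
  symbol :> finType;
  arity : symbol -> nat;
  arity_gt0 : forall P : symbol, (0 < arity P)%N }.

(* Quantifier-free formulas in the variables x_0, ..., x_(n-1). *)
Inductive open_formula (L : language) (n : nat) : Type :=
  | FAtom (P : L) of 'I_(arity P) -> 'I_n
  | FEq of 'I_n & 'I_n
  | FNot of open_formula L n
  | FAnd of open_formula L n & open_formula L n
  | FOr of open_formula L n & open_formula L n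
  | FImp of open_formula L n & open_formula L n.

Arguments FAtom {L n} P _.
Arguments FEq {L n} _ _.

(* [UFormula n F] is the sentence "for all x_0, ..., x_(n-1), F". *)
Record universal_formula (L : language) := UFormula {
  nvars : nat;
  matrix_of : open_formula L nvars }.

Arguments UFormula {L} nvars matrix_of.

Definition universal_theory (L : language) := set (universal_formula L).

Record structure (L : language) (V : Type) := Structure {
  interp :> forall P : L, set ('I_(arity P) -> V) }.

Arguments interp {L V} _ P _.

Section satisfaction.
Context (L : language) (V : Type) (M : structure L V).

Fixpoint holds n (x : 'I_n -> V) (F : open_formula L n) : Prop :=
  match F with
  | FAtom P v => M P (x \o v)
  | FEq i j => x i = x j
  | FNot G => ~ holds x G
  | FAnd G H => holds x G /\ holds x H
  | FOr G H => holds x G \/ holds x H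
  | FImp G H => holds x G -> holds x H
  end.

Definition satisfies (A : universal_formula L) : Prop :=
  forall x : 'I_(nvars A) -> V, holds x (matrix_of A).

Definition model_of (T : universal_theory L) : Prop :=
  forall A, T A -> satisfies A.

Definition canonical_structure : Prop :=
  forall (P : L) (t : 'I_(arity P) -> V), M P t -> injective t.

End satisfaction.

Definition entails (L : language) (T : universal_theory L)
    (A : universal_formula L) : Prop :=
  forall (V : Type) (M : structure L V), model_of M T -> satisfies M A.

Definition canonical_theory (L : language) (T : universal_theory L) : Prop :=
  forall (P : L) (i j : 'I_(arity P)), (i < j)%N ->
    entails T (UFormula (arity P) (FImp (FEq i j) (FNot (FAtom P id)))).

Section lebesgue.
Context (R : realType) (I : finType).
Local Open Scope ereal_scope.

Definition box (a b : I -> R) : set (I -> R) :=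
  [set x | forall i, (a i <= x i <= b i)%R].

Definition volume (a b : I -> R) : R := (\prod_(i : I) (b i - a i))%R.

(* The boxes of a cover are indexed by the [k] with [D k], so that finite
   covers, and the empty cover of [set0], are allowed; this matters when [I]
   is empty, where every box is a point of volume 1. *)
Definition lebesgue_outer (A : set (I -> R)) : \bar R :=
  ereal_inf [set s | exists (D : pred nat) (a b : nat -> I -> R),
    [/\ forall k i, (a k i <= b k i)%R,
        A `<=` \bigcup_(k in [set k | D k]) box (a k) (b k) &
        s = \sum_(k <oo | D k) (volume (a k) (b k))%:E]].

Lemma volume_ge0 (a b : I -> R) :
  (forall i, (a i <= b i)%R) -> (0 <= volume a b)%R.
Proof. by move=> ab; apply: prodr_ge0 => i _; rewrite subr_ge0. Qed.

Lemma lebesgue_outer_ge0 A : 0 <= lebesgue_outer A.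
Proof.
apply: le_ereal_inf_tmp => _ [D [a [b [ab _ ->]]]].
by apply: nneseries_ge0 => k _ _; rewrite lee_fin volume_ge0.
Qed.

Lemma lebesgue_outer0 : lebesgue_outer set0 = 0.
Proof.
apply/eqP; rewrite eq_le lebesgue_outer_ge0 andbT.
apply: ereal_inf_lbound; exists pred0, (fun=> fun=> 0%R), (fun=> fun=> 0%R).
by split=> //; rewrite eseries_pred0.
Qed.

Lemma le_lebesgue_outer :
  {homo lebesgue_outer : A B / A `<=` B >-> A <= B}.
Proof.
move=> A B AB; apply: ereal_inf_le_tmp => _ [D [a [b [ab BD ->]]]].
by exists D, a, b; split=> //; exact: subset_trans BD.
Qed.

Lemma lebesgue_outer_sigma_subadditive : sigma_subadditive lebesgue_outer.
Proof.
move=> A; have [[i ioo]|] := pselect (exists i, lebesgue_outer (A i) = +oo).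
  rewrite (eseries_pinfty _ _ ioo) ?leey// => n _.
  by rewrite -ltNye (lt_le_trans _ (lebesgue_outer_ge0 _)).
rewrite -forallNE => Aoo.
apply/lee_addgt0Pr => e e0.
rewrite (le_trans _ (epsilon_trick _ _ (ltW e0)))//; last first.
  by move=> n; exact: lebesgue_outer_ge0.
pose cover := (pred nat * ((nat -> I -> R) * (nat -> I -> R)))%type.
pose Q n (C : cover) := [/\ forall k i, (C.2.1 k i <= C.2.2 k i)%R,
    A n `<=` \bigcup_(k in [set k | C.1 k]) box (C.2.1 k) (C.2.2 k) &
    \sum_(k <oo | C.1 k) (volume (C.2.1 k) (C.2.2 k))%:E <=
      lebesgue_outer (A n) + (e / (2 ^ n.+1)%:R)%:E].
have [C QC] : {C : nat -> cover & forall n, Q n (C n)}.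
  apply: (@choice _ _ Q) => n.
  have en : (0 < e / (2 ^ n.+1)%:R)%R by rewrite divr_gt0// ltr0n expn_gt0.
  have fA : lebesgue_outer (A n) \is a fin_num.
    rewrite ge0_fin_numE ?lebesgue_outer_ge0//.
    by rewrite ltey; apply/eqP; exact: Aoo.
  have [s [D [a [b [ab AD ->]]]] sA] := lb_ereal_inf_adherent en fA.
  by exists (D, (a, b)); split=> //=; exact: ltW.
pose v (p : nat * nat) : \bar R :=
  (volume ((C p.1).2.1 p.2) ((C p.1).2.2 p.2))%:E.
have v0 p : 0 <= v p by case: (QC p.1) => ab _ _; rewrite lee_fin volume_ge0.
apply: (@le_trans _ _ (\sum_(n <oo) \sum_(k <oo | (C n).1 k) v (n, k)));
  last by apply: lee_nneseries => n _ *;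
    [apply: nneseries_ge0 => k _ _; exact: v0|case: (QC n)].
rewrite nneseries_esumT; last by move=> n; apply: nneseries_ge0.
under eq_esum do rewrite nneseries_esum//.
rewrite (@esum_esum _ _ _ _ (fun n => [set k | (C n).1 k])
  (fun n k => v (n, k)))//.
have /card_esym/ppcard_eqP[f] := card_nat2.
set K := (X in \esum_(_ in X) _).
apply: ereal_inf_lbound.
exists (fun m => (C (f m).1).1 (f m).2), (fun m => (C (f m).1).2.1 (f m).2),
  (fun m => (C (f m).1).2.2 (f m).2); split.
- by move=> m i; case: (QC (f m).1).
- move=> x [n _ Anx]; have [_ /(_ x Anx)[k Dk xk] _] := QC n.
  by exists (f^-1%FUN (n, k)) => /=; rewrite invK ?inE.
- rewrite nneseries_esum; last by move=> m _; exact: (v0 (f m)).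
  rewrite (@reindex_esum _ _ _ [set m | (C (f m).1).1 (f m).2] K f)//.
  split=> [m /= Dm|m m' _ _|[n k] /= [_ Dk]]; first by split.
    by apply: inj; rewrite inE.
  by exists (f^-1%FUN (n, k)) => /=; rewrite invK ?inE.
Qed.

HB.instance Definition _ := isOuterMeasure.Build R (I -> R) lebesgue_outer
  lebesgue_outer0 lebesgue_outer_ge0 le_lebesgue_outer
  lebesgue_outer_sigma_subadditive.

Definition lebesgue_measurable (A : set (I -> R)) : Prop :=
  lebesgue_outer.-cara.-measurable A.

(* Lebesgue measure on R^I, defined on the complete sigma-algebra of
   Lebesgue measurable sets. *)
Definition lambda : set (caratheodory_type lebesgue_outer) -> \bar R :=
  lebesgue_outer.

HB.instance Definition _ := isMeasure.Build _ _ _ lambda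
  (caratheodory_measure0 lebesgue_outer)
  (caratheodory_measure_ge0 (mu := lebesgue_outer))
  (@caratheodory_measure_sigma_additive _ _ lebesgue_outer).

End lebesgue.

Arguments lambda {R I} _.

Definition r (V : finType) := {A : {set V} | A != finset.set0}.

Lemma imset_neq0 (U V : finType) (alpha : U -> V) (A : r U) :
  alpha @: sval A != finset.set0.
Proof.
have /set0Pn[u uA] := svalP A.
by apply/set0Pn; exists (alpha u); exact: imset_f.
Qed.

Definition r_image (U V : finType) (alpha : U -> V) (A : r U) : r V :=
  exist _ (alpha @: sval A) (imset_neq0 alpha A).

Lemma set1_neq0 (V : finType) (i : V) : [set i]%SET != finset.set0.
Proof. by apply/set0Pn; exists i; rewrite inE. Qed.

Definition r_singleton (V : finType) (i : V) : r V :=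
  exist _ [set i]%SET (set1_neq0 i).

(* Points of E_V are represented as functions into R with values in [0, 1]. *)
Definition cube (R : realType) (V : finType) : set (r V -> R) :=
  [set x | forall A, 0 <= x A <= 1].

Arguments cube R V : clear implicits.

Definition pullback (R : realType) (U V : finType) (alpha : U -> V)
    (x : r V -> R) : r U -> R := fun A => x (r_image alpha A).

Record euclidean_structure (R : realType) (L : language) := EuclideanStructure {
  pon :> forall P : L, set (r 'I_(arity P) -> R);
  pon_sub : forall P : L, @pon P `<=` cube R 'I_(arity P);
  pon_measurable : forall P : L, lebesgue_measurable (@pon P) }.

Arguments pon {R L} _ P _.

Definition R_in (L : language) (V : finType) (M : structure L V) (P : L) :
    set ('I_(arity P) -> V) :=
  [set alpha | injective alpha /\ M P alpha].

Arguments R_in {L V} M P _.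

Definition R_out (L : language) (V : finType) (M : structure L V) (P : L) :
    set ('I_(arity P) -> V) :=
  [set alpha | injective alpha /\ ~ M P alpha].

Arguments R_out {L V} M P _.

Section induced_density.
Context (R : realType) (L : language) (V : finType).

Definition T_ind (M : structure L V) (N : euclidean_structure R L) :
    set (r V -> R) :=
  cube R V `&`
  \bigcap_(P in [set: L])
    ((\bigcap_(alpha in R_in M P) pullback alpha @^-1` N P) `&`
     (\bigcap_(alpha in R_out M P)
        pullback alpha @^-1` (cube R 'I_(arity P) `\` N P))).

Definition t_ind (M : structure L V) (N : euclidean_structure R L) : \bar R :=
  lambda (T_ind M N).

Definition diagonal : set (r V -> R) :=
  [set x | cube R V x /\
    exists i j : V, i != j /\ x (r_singleton i) = x (r_singleton j)].

End induced_density.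

Arguments diagonal R V : clear implicits.

Definition weak_on (R : realType) (L : language) (T : universal_theory L)
    (N : euclidean_structure R L) : Prop :=
  forall (V : finType) (M : structure L V),
    canonical_structure M -> ~ model_of M T -> t_ind M N = 0%E.

Definition strong_on (R : realType) (L : language) (T : universal_theory L)
    (N : euclidean_structure R L) : Prop :=
  forall (V : finType) (M : structure L V),
    canonical_structure M -> ~ model_of M T ->
    T_ind M N `<=` diagonal R V.

(* Main.v *)
Require Import Defs.
From mathcomp Require Import all_boot all_order all_algebra.
From mathcomp Require Import all_classical all_reals all_analysis.
From mathcomp Require Import measurable_realfun.

(** Off the diagonal, a point [x] of E_V is a simplex on vertices [x_{i}] all of
    whose faces are labelled, and a face determines the labels below it. Perturb
    the labels of all labelled faces independently, each one uniformly in the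
    cell of its label for a finite partition of [0, 1]. The perturbation of [x]
    is then uniform in a box around [x], so almost surely its induced structure
    is a model of [T]; and at almost every [z] membership in [N P] is kept with
    probability tending to 1 along a suitable sequence of partitions. These
    likely events, taken over all finite sets of faces, generate a proper
    filter. Any ultrafilter finer than it decides membership at the remaining
    null set of points, simultaneously and consistently with [T]. *)

Import Order.TTheory GRing.Theory Num.Theory.
Import numFieldNormedType.Exports.

Set Implicit Arguments.
Unset Strict Implicit.
Unset Printing Implicit Defensive.

Local Open Scope classical_set_scope.
Local Open Scope ring_scope.

(** * Lower bound for the outer measure of an open box *)

Definition open_box (R : realType) (I : finType) (l h : I -> R) : set (I -> R) :=
  [set x | forall i, l i < x i < h i].

Section volume_lower_bound.
Context (R : realType).
Local Open Scope ereal_scope.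

(** Integrate the pointwise inequality over [t]; monotone convergence exchanges series and
    integral. *)
Lemma le_length_nneseries (c l h : R) (ck a b : nat -> R) :
  (0 <= c)%R -> (l <= h)%R -> (forall k, 0 <= ck k)%R ->
  (forall k, a k <= b k)%R ->
  (forall t : R, (c * \1_`]l, h[ t)%:E <=
    \sum_(k <oo) (ck k * \1_`[a k, b k] t)%:E) ->
  (c * (h - l))%:E <= \sum_(k <oo) (ck k * (b k - a k))%:E.
Proof.
move=> c0 lh ck0 ab H.
have intE (d u v : R) (x y : bool) : (0 <= d)%R -> (u <= v)%R ->
    \int[lebesgue_measure]_t
      (d * \1_[set` Interval (BSide x u) (BSide y v)] t)%:E =
    (d * (v - u))%:E.
  move=> d0 uv; under eq_integral do rewrite EFinM.
  rewrite ge0_integralZl ?lee_fin//; last first.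
    by apply/measurable_EFinP; exact: measurable_indic.
  rewrite integral_indic//= setIT lebesgue_measure_itv/= lte_fin.
  move: uv; rewrite le_eqVlt => /predU1P[->|->]; last by rewrite -EFinB -EFinM.
  by rewrite ltxx subrr mulr0 mule0.
rewrite -(intE c l h false true c0 lh).
under [leRHS]eq_eseriesr => k _ do rewrite -(intE _ _ _ true false (ck0 k) (ab k)).
rewrite -integral_nneseries//; last 2 first.
- move=> k; apply/measurable_EFinP; apply: measurable_funM => //.
- by move=> k t _; rewrite lee_fin mulr_ge0// indicE ler0n.
apply: ge0_le_integral => //.
- by move=> t _; rewrite lee_fin mulr_ge0// indicE ler0n.
- by apply/measurable_EFinP; apply: measurable_funM.
- apply: ge0_emeasurable_sum => k.
  + by move=> t _; rewrite lee_fin mulr_ge0// indicE ler0n.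
  + by move=> _; apply/measurable_EFinP; apply: measurable_funM.
Qed.

Context (I : finType).

(** The intermediate integrand: coordinates in [s] are already integrated out, the others are still
    evaluated at [x]. *)
Let mixed (s : seq I) (X : I -> set R) (len : I -> R) (x : I -> R) : R :=
  (\prod_i (if i \in s then len i else \1_(X i) (x i)))%R.

Let mixed_nil X len x : mixed [::] X len x = (\prod_i \1_(X i) (x i))%R.
Proof. exact: eq_bigr. Qed.

Let mixed_ge0 s X len x : (forall i, 0 <= len i)%R -> (0 <= mixed s X len x)%R.
Proof.
by move=> len0; apply: prodr_ge0 => i _; case: ifP => // _; rewrite indicE.
Qed.

(* A cover by boxes is an inequality between products of indicators;
   integrating one coordinate at a time turns it into one between volumes. *)
Lemma volume_le_cover (l h : I -> R) (D : pred nat) (a b : nat -> I -> R) :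
  (forall i, l i <= h i)%R -> (forall k i, a k i <= b k i)%R ->
  open_box l h `<=` \bigcup_(k in [set k | D k]) box (a k) (b k) ->
  (volume l h)%:E <= \sum_(k <oo | D k) (volume (a k) (b k))%:E.
Proof.
move=> lh ab cov.
(* For [s] empty this is the covering hypothesis at [x]; for [s := enum I] it no longer depends on
   [x] and is the claim. *)
suff H (s : seq I) (x : I -> R) :
    (mixed s (fun i => `]l i, h i[%classic) (h \- l) x)%:E <=
    \sum_(k <oo) (if D k then mixed s (fun i => `[a k i, b k i]%classic)
                                 (b k \- a k) x else 0)%:E.
  have vE u v (X : I -> set R) x :
      mixed (enum I) X (v \- u)%R x = volume u v.
    by apply: eq_bigr => i _; rewrite mem_enum.
  rewrite eseries_mkcond; have := H (enum I) l; rewrite vE => /le_trans; apply.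
  rewrite le_eqVlt; apply/orP; left; apply/eqP; apply: eq_eseriesr => k _.
  by case: ifP => // _; rewrite vE.
elim: s x => [|i s IH] x.
  have mk0 k : 0 <= (if D k then mixed [::] (fun i => `[a k i, b k i]%classic)
      (b k \- a k)%R x else 0%R)%:E.
    by case: ifP => // _; rewrite lee_fin mixed_ge0// => i; rewrite subr_ge0.
  rewrite mixed_nil; have [xlh|] := pselect (open_box l h x); last first.
    move=> /existsNP[i xi]; rewrite (bigD1 i)//= indicE memNset ?mul0r.
      exact: nneseries_ge0.
    by rewrite /= in_itv/=.
  rewrite [X in X%:E <= _]big1 => [|i _]; last first.
    by rewrite indicE mem_set//= in_itv/= xlh.
  have [k /= Dk xk] := cov _ xlh.
  rewrite (nneseries_split 0%N k.+1)// add0n big_nat_recr//= Dk.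
  rewrite mixed_nil [X in _ + X%:E + _]big1 => [|i _]; last first.
    by rewrite indicE mem_set//= in_itv/= xk.
  rewrite -addeA addeCA leeDl// adde_ge0//; first exact: sume_ge0.
  exact: nneseries_ge0.
have [iS|iS] := boolP (i \in s).
  have mE X len : mixed (i :: s) X len x = mixed s X len x.
    apply: eq_bigr => j _; rewrite inE.
    by case: eqVneq => //= ->; rewrite iS.
  rewrite mE; under eq_eseriesr do rewrite mE; exact: IH.
pose rest X len : R :=
  (\prod_(j | j != i) (if j \in s then len j else \1_(X j) (x j)))%R.
have rest0 X len : (forall j, 0 <= len j)%R -> (0 <= rest X len)%R.
  by move=> len0; apply: prodr_ge0 => j _; case: ifP => // _; rewrite indicE ler0n.
have mS X len : mixed (i :: s) X len x = (rest X len * len i)%R.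
  rewrite /mixed (bigD1 i)//= inE eqxx mulrC; congr (_ * _)%R.
  by apply: eq_bigr => j ji; rewrite inE (negbTE ji).
have mt X len t : mixed s X len (fun j => if j == i then t else x j) =
    (rest X len * \1_(X i) t)%R.
  rewrite /mixed (bigD1 i)//= (negbTE iS) eqxx mulrC; congr (_ * _)%R.
  by apply: eq_bigr => j ji; rewrite (negbTE ji).
rewrite mS /=.
have -> : \sum_(k <oo) (if D k then mixed (i :: s) (fun i => `[a k i, b k i]%classic)
    (b k \- a k)%R x else 0%R)%:E = \sum_(k <oo) ((if D k then
    rest (fun i => `[a k i, b k i]%classic) (b k \- a k)%R else 0%R) * (b k i - a k i))%:E.
  by apply: eq_eseriesr => k _; case: ifP => _; rewrite ?mul0r// mS.
apply: le_length_nneseries => //.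
- by apply: rest0 => j; rewrite subr_ge0.
- by move=> k; case: ifP => // _; apply: rest0 => j; rewrite subr_ge0.
move=> t; have := IH (fun j => if j == i then t else x j); rewrite mt.
move=> /le_trans; apply; rewrite le_eqVlt; apply/orP; left; apply/eqP.
by apply: eq_eseriesr => k _; case: ifP => _; rewrite ?mul0r// mt.
Qed.

Lemma volume_le_outer_open_box (l h : I -> R) : (forall i, l i <= h i)%R ->
  (volume l h)%:E <= lebesgue_outer (open_box l h).
Proof.
move=> lh; apply: le_ereal_inf_tmp => _ [D [a [b [ab cov ->]]]].
exact: volume_le_cover.
Qed.

End volume_lower_bound.

(** * Upper bounds and measurability for boxes *)

Section outer_measure_of_boxes.
Context (R : realType) (I : finType).
Local Open Scope ereal_scope.
Implicit Types (a b l h : I -> R).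

Lemma lebesgue_outerU (A B : set (I -> R)) :
  lebesgue_outer (A `|` B) <= lebesgue_outer A + lebesgue_outer B.
Proof. exact: outer_measureU2. Qed.

Lemma outer_box a b : (forall i, a i <= b i)%R ->
  lebesgue_outer (box a b) <= (volume a b)%:E.
Proof.
move=> ab; apply: ereal_inf_lbound.
exists (pred1 0%N), (fun=> a), (fun=> b); split => //; first by move=> x; exists 0%N.
rewrite (nneseries_split_cond 0 1)//; last first.
  by move=> k _; rewrite lee_fin volume_ge0.
by rewrite add0n big_ltn_cond//= big_geq//= adde0 eseries0 ?adde0// => -[].
Qed.

Lemma outer_open_box_le l h : (forall i, l i <= h i)%R ->
  lebesgue_outer (open_box l h) <= (volume l h)%:E.
Proof.
move=> lh; apply: le_trans (outer_box lh); apply: le_lebesgue_outer => x xlh i.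
by have /andP[/ltW -> /ltW ->] := xlh i.
Qed.

Lemma volume_split a b i (m : R) :
  volume a b = (volume a (fun j => if j == i then m else b j) +
                volume (fun j => if j == i then m else a j) b)%R.
Proof.
rewrite /volume !(bigD1 i (P := xpredT))//= !eqxx.
rewrite [in X in _ = (_ * X + _)%R](eq_bigr (fun j => b j - a j)%R); last first.
  by move=> j /negbTE ->.
rewrite [in X in _ = (_ + _ * X)%R](eq_bigr (fun j => b j - a j)%R); last first.
  by move=> j /negbTE ->.
by rewrite -mulrDl [in RHS]addrC subrKA.
Qed.

(** The hyperplane [x i = e] is left free, so that open and closed half-spaces are both covered.
    Cutting every box of a cover along it splits the total volume additively. *)
Lemma half_space_measurable i (e : R) (H : set (I -> R)) :
  (forall x, H x -> x i <= e)%R -> (forall x, ~ H x -> e <= x i)%R ->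
  lebesgue_measurable H.
Proof.
move=> He nHe; apply: le_caratheodory_measurable => X /=.
apply: le_ereal_inf_tmp => _ [D [a [b [ab cov ->]]]].
(* [e] is clamped to the side of the box, so a box that the hyperplane misses splits into itself and
   a degenerate box. *)
pose m k := Num.max (a k i) (Num.min (b k i) e).
have am k : (a k i <= m k)%R by rewrite le_max lexx.
have mb k : (m k <= b k i)%R by rewrite ge_max ab ge_min lexx.
pose b' k j := if j == i then m k else b k j.
pose a' k j := if j == i then m k else a k j.
have ab' k j : (a k j <= b' k j)%R by rewrite /b'; case: eqP => // ->.
have a'b k j : (a' k j <= b k j)%R by rewrite /a'; case: eqP => // ->.
have -> : \sum_(k <oo | D k) (volume (a k) (b k))%:E =
    \sum_(k <oo | D k) (volume (a k) (b' k))%:E +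
    \sum_(k <oo | D k) (volume (a' k) (b k))%:E.
  rewrite -nneseriesD; last 2 first.
  - by move=> k _; rewrite lee_fin volume_ge0.
  - by move=> k _; rewrite lee_fin volume_ge0.
  by apply: eq_eseriesr => k _; rewrite -EFinD (volume_split _ _ i (m k)).
apply: leeD; apply: ereal_inf_lbound.
- exists D, a, b'; split => // x [/cov[k Dk xk] /He xe]; exists k => // j.
  have /andP[ax xb] := xk j; rewrite ax/= /b'; case: eqP => [ji|//].
  by subst j; rewrite le_max le_min xb xe orbT.
- exists D, a', b; split => // x [/cov[k Dk xk] /nHe xe]; exists k => // j.
  have /andP[ax xb] := xk j; rewrite xb andbT /a'; case: eqP => [ji|//].
  by subst j; rewrite ge_max ax ge_min xe orbT.
Qed.

Lemma measurable_forall (A : I -> set (I -> R)) :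
  (forall i, lebesgue_measurable (A i)) ->
  lebesgue_measurable [set x | forall i, A i x].
Proof.
move=> mA; have -> : [set x | forall i, A i x] = \big[setI/setT]_i A i.
  rewrite -bigcap_seq; apply/seteqP; split => [x xA i _|x xA i]; first exact: xA.
  by apply: xA; rewrite /= mem_index_enum.
by apply: (@bigsetI_measurable _ (caratheodory_type (@lebesgue_outer R I))) => i _;
  exact: mA.
Qed.

Lemma box_measurable a b : lebesgue_measurable (box a b).
Proof.
apply: (@measurable_forall (fun i => [set x | a i <= x i <= b i]%R)) => i.
have -> : [set x : I -> R | a i <= x i <= b i]%R =
    ~` [set x | x i < a i]%R `&` [set x | x i <= b i]%R.
  apply/seteqP; split => x /=; first by case/andP => /le_gtF ->.
  by case=> /negP; rewrite -leNgt => -> ->.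
apply: caratheodory_measurable_setI; first apply: caratheodory_measurable_setC.
- apply: (@half_space_measurable i (a i)) => x /=; first exact: ltW.
  by move/negP; rewrite -leNgt.
- by apply: (@half_space_measurable i (b i)) => x //= /negP; rewrite -ltNge => /ltW.
Qed.

Lemma open_box_measurable l h : lebesgue_measurable (open_box l h).
Proof.
apply: (@measurable_forall (fun i => [set x | l i < x i < h i]%R)) => i.
have -> : [set x : I -> R | l i < x i < h i]%R =
    ~` [set x | x i <= l i]%R `&` [set x | x i < h i]%R.
  apply/seteqP; split => x /=; first by case/andP => /lt_geF ->.
  by case=> /negP; rewrite -ltNge => -> ->.
apply: caratheodory_measurable_setI; first apply: caratheodory_measurable_setC.
- by apply: (@half_space_measurable i (l i)) => x //= /negP; rewrite -ltNge => /ltW.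
- apply: (@half_space_measurable i (h i)) => x /=; first exact: ltW.
  by move/negP; rewrite -leNgt.
Qed.

End outer_measure_of_boxes.

(** Adding irrelevant coordinates preserves a bound on the share of a box: covering boxes are
    extended by the full sides of [l], [h] outside the image of [kappa], which multiplies every
    volume by the same [W]. *)
Lemma outer_pullback (R : realType) (I J : finType) (kappa : I -> J)
    (l h : J -> R) (S : set (I -> R)) (eps : R) :
  injective kappa -> (forall j, l j < h j) ->
  (lebesgue_outer S <= (eps * volume (l \o kappa) (h \o kappa))%:E)%E ->
  (lebesgue_outer (open_box l h `&` [set u : J -> R | S (u \o kappa)]) <=
    (eps * volume l h)%:E)%E.
Proof.
move=> inj lh SE.
pose W := \prod_(j | j \notin codom kappa) (h j - l j).
have W0 : 0 < W by apply: prodr_gt0 => j _; rewrite subr_gt0.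
pose ext (a : I -> R) (l : J -> R) j :=
  if [pick i | kappa i == j] is Some i then a i else l j.
have extK a l0 i : ext a l0 (kappa i) = a i.
  rewrite /ext; case: pickP => [i' /eqP/inj -> //|/(_ i)].
  by rewrite eqxx.
have extN a l0 j : j \notin codom kappa -> ext a l0 j = l0 j.
  rewrite /ext; case: pickP => // i /eqP <-; by rewrite codom_f.
have volE a b : volume (ext a l) (ext b h) = volume a b * W.
  rewrite /volume (bigID (mem (codom kappa)))/=; congr (_ * _).
    rewrite -big_uniq/=; last by rewrite map_inj_uniq ?enum_uniq.
    by rewrite big_map big_enum; apply: eq_bigr => i _; rewrite !extK.
  by apply: eq_bigr => j jk; rewrite !extN.
have vlh : volume l h = volume (l \o kappa) (h \o kappa) * W.
  rewrite -volE; apply: eq_bigr => j _; rewrite /ext.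
  by case: pickP => // i /eqP <-.
rewrite vlh mulrA EFinM -lee_pdivrMr//.
apply: le_trans SE; apply: le_ereal_inf_tmp => _ [D [a [b [ab cov ->]]]].
rewrite lee_pdivrMr// muleC -nneseriesZl; last first.
  by move=> k _; rewrite lee_fin volume_ge0.
apply: ereal_inf_lbound.
exists D, (fun k => ext (a k) l), (fun k => ext (b k) h); split.
- by move=> k j; rewrite /ext; case: pickP => // _; exact: ltW.
- move=> u [ulh /cov[k Dk uk]]; exists k => // j; rewrite /ext.
  case: pickP => [i /eqP <-|_]; first exact: uk.
  by have /andP[/ltW -> /ltW ->] := ulh j.
- by apply: eq_eseriesr => k _; rewrite volE mulrC.
Qed.

(** * Finite partitions of [0, 1] and the product cells they define *)

Section cells.
Context (R : realType).

(* Points of [E] outside ]0, 1[ are ignored, so that no cell is degenerate. *)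
Definition cell_left (E : seq R) (t : R) : R :=
  \big[Num.max/0]_(e <- E | (0 < e < 1) && (e <= t)) e.

Definition cell_right (E : seq R) (t : R) : R :=
  \big[Num.min/1]_(e <- E | (0 < e < 1) && (t < e)) e.

Lemma cell_left_ge0 E t : 0 <= cell_left E t.
Proof. exact: bigmax_ge_id. Qed.

Lemma cell_right_le1 E t : cell_right E t <= 1.
Proof. exact: bigmin_le_id. Qed.

Lemma cell_left_lt_right E t : cell_left E t < cell_right E t.
Proof.
apply: lt_bigmin => [|e /andP[/andP[e0 e1] te]]; apply: bigmax_lt => //.
  by move=> e /andP[/andP[]].
by move=> e' /andP[_ /le_lt_trans]; apply.
Qed.

Lemma mem_cell E t : t \notin E -> 0 < t < 1 ->
  cell_left E t < t < cell_right E t.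
Proof.
move=> tE /andP[t0 t1]; apply/andP; split.
- rewrite /cell_left big_seq_cond; apply: bigmax_lt => // e /and3P[eE _ et].
  by rewrite lt_neqAle et andbT; apply: contraNneq tE => <-.
- by apply: lt_bigmin => // e /andP[].
Qed.

Lemma cell_sep E t e : e \in E -> e <= cell_left E t \/ cell_right E t <= e.
Proof.
move=> eE; have [e0|e0] := leP e 0; first by left; exact: le_trans (cell_left_ge0 _ _).
have [e1|e1] := leP 1 e; first by right; exact: le_trans (cell_right_le1 _ _) _.
have [et|te] := leP e t; [left|right].
- by apply: (@le_bigmax_seq _ _ _ _ _ e _ id eE) => //; rewrite e0 e1.
- by apply: (@ge_bigmin_seq _ _ _ _ _ e _ id eE) => //; rewrite e0 e1.
Qed.

(** A point strictly inside the cell of [t] compares with the relevant points of [E] as [t] does.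
    Hence two cells are equal or disjoint. *)
Lemma cell_eq E s t : cell_left E t < s < cell_right E t ->
  cell_left E s = cell_left E t /\ cell_right E s = cell_right E t.
Proof.
move=> /andP[ls sr].
have H e : e \in E -> 0 < e < 1 -> (e <= s) = (e <= t).
  move=> eE e01; have [et|te] := leP e t.
    apply: ltW; apply: le_lt_trans ls; apply: (@le_bigmax_seq _ _ _ _ _ e _ id eE) => //.
    by rewrite e01.
  apply/negbTE; rewrite -ltNge; apply: lt_le_trans sr _.
  by apply: (@ge_bigmin_seq _ _ _ _ _ e _ id eE) => //; rewrite e01.
split; rewrite /cell_left /cell_right big_seq_cond [RHS]big_seq_cond;
  apply: eq_bigl => e; case eE: (e \in E) => //=; case e01: (0 < e < 1) => //=.
- exact: H.
- by rewrite !ltNge H.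
Qed.

Context (I : finType).

(** [x] itself is outside when one of its coordinates is a cell boundary or lies outside ]0, 1[. *)
Definition cell_box (E : seq R) (x : I -> R) : set (I -> R) :=
  open_box (cell_left E \o x) (cell_right E \o x).

Definition cell_volume (E : seq R) (x : I -> R) : R :=
  volume (cell_left E \o x) (cell_right E \o x).

Lemma cell_box_eq E x y : cell_box E x y ->
  cell_left E \o y = cell_left E \o x /\ cell_right E \o y = cell_right E \o x.
Proof. by move=> xy; split; apply/funext => i /=; case: (cell_eq (xy i)). Qed.

Lemma box_cell_box E x (a b u v : I -> R) :
  (forall i, a i \in E) -> (forall i, b i \in E) ->
  cell_box E x u -> cell_box E x v -> box a b u -> box a b v.
Proof.
move=> aE bE xu xv abu i; have /andP[lu ur] := xu i; have /andP[lv vr] := xv i.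
have /andP[au ub] := abu i; apply/andP; split.
- have [al|ra] := cell_sep (x i) (aE i); first exact: le_trans al (ltW lv).
  by have := lt_le_trans ur ra; rewrite ltNge au.
- have [bl|rb] := cell_sep (x i) (bE i); last exact: le_trans (ltW vr) rb.
  by have := le_lt_trans bl lu; rewrite ltNge ub.
Qed.

(** A cell only depends on which points of [E] lie below each coordinate, recorded here by one
    boolean mask per coordinate. *)
Lemma finite_cell_boxes E : finite_set [set cell_box E x | x in setT].
Proof.
pose G (c : {ffun I -> (size E).-tuple bool}) : set (I -> R) := open_box
  (fun i => \big[Num.max/0]_(e <- mask (c i) E | 0 < e < 1) e)
  (fun i => \big[Num.min/1]_(e <- mask (map negb (c i)) E | 0 < e < 1) e).
apply: (@sub_finite_set _ _ (range G)); last by apply: finite_image; exact: finite_finset.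
move=> _ [x _ <-]; exists [ffun i => [tuple of map (fun e => e <= x i) (in_tuple E)]] => //.
rewrite /G /cell_box; congr (open_box _ _); apply/funext => i; rewrite ffunE/=.
- by rewrite -filter_mask big_filter_cond; apply: eq_bigl => e; rewrite andbC.
- rewrite -map_comp -filter_mask big_filter_cond; apply: eq_bigl => e.
  by rewrite [RHS]andbC /= (ltNge (x i)).
Qed.

End cells.

(** * Density points with respect to a sequence of partitions *)

Section density.
Context (R : realType).
Local Open Scope ereal_scope.

(* Markov's inequality for the fraction of a cell occupied by [S]. *)
Lemma markov_cells (I : finType) (E : seq R) (S : set (I -> R)) (eta : R) :
  lebesgue_measurable S -> (0 < eta)%R ->
  exists B : set (I -> R), [/\ lebesgue_measurable B,
    eta%:E * lebesgue_outer B <= lebesgue_outer S &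
    forall x, cell_box E x x -> ~ B x ->
      lebesgue_outer (S `&` cell_box E x) <= (eta * cell_volume E x)%:E].
Proof.
move=> mS eta0.
(* The overfull cells are finitely many, disjoint and measurable, so their measures can be added. *)
pose Q := [set X | exists2 x, X = cell_box E x &
  (eta * cell_volume E x)%:E < lebesgue_outer (S `&` cell_box E x)].
have finQ : finite_set Q.
  by apply: sub_finite_set (finite_cell_boxes I E) => _ [x -> _]; exists x.
have mQ X : Q X -> lebesgue_measurable X.
  by move=> [x -> _]; exact: open_box_measurable.
have tQ : trivIset Q id.
  move=> _ _ [x -> _] [y -> _] [z [xz yz]]; rewrite /cell_box.
  by have [<- <-] := cell_box_eq xz; have [<- <-] := cell_box_eq yz.
pose T := caratheodory_type (@lebesgue_outer R I).
have mSQ (X : set T) : Q X -> lebesgue_measurable (S `&` X).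
  by move=> QX; apply: caratheodory_measurable_setI => //; exact: mQ.
have tSQ : trivIset Q (fun X : set T => S `&` X).
  by move=> X Y QX QY [z [[_ Xz] [_ Yz]]]; apply: tQ => //; exists z.
exists (\bigcup_(X in Q) X); split.
- exact: (@fin_bigcup_measurable _ T).
- have -> : lebesgue_outer (\bigcup_(X in Q) X) =
      (\sum_(X \in Q) lebesgue_outer X)%R.
    exact: (@measure_fin_bigcup _ _ T lambda _ Q id).
  rewrite ge0_mule_fsumr; last by move=> X; exact: lebesgue_outer_ge0.
  apply: (@le_trans _ _ (\sum_(X \in Q) lebesgue_outer (S `&` X))%R).
    apply: lee_fsum => // _ [x -> /ltW]; apply: le_trans; rewrite EFinM.
    rewrite lee_pmul2l// ?lte_fin//; apply: outer_open_box_le => i.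
    exact/ltW/cell_left_lt_right.
  have <- : lebesgue_outer (\bigcup_(X in Q) (S `&` X)) =
      (\sum_(X \in Q) lebesgue_outer (S `&` X))%R.
    exact: (@measure_fin_bigcup _ _ T lambda _ Q (fun X => S `&` X)).
  by apply: le_lebesgue_outer => x [X _ []].
- move=> x xx nBx; rewrite leNgt; apply/negP => lt; apply: nBx.
  by exists (cell_box E x) => //; exists x.
Qed.

(** Take a cover by boxes whose total volume is within [delta / 2] of optimal, and cut off a tail of
    volume below [delta / 2]. Measurability of [A] bounds the excess of the cover over [A]. *)
Lemma approx_by_boxes (I : finType) (A : set (I -> R)) (delta : R) :
  lebesgue_measurable A -> lebesgue_outer A < +oo -> (0 < delta)%R ->
  exists n (D : pred nat) (a b : nat -> I -> R),
    lebesgue_outer (A `+` \bigcup_(k in [set k | (k < n)%N && D k])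
      box (a k) (b k)) <= delta%:E.
Proof.
move=> mA Aoo d0.
have d20 : (0 < delta / 2)%R by rewrite divr_gt0.
have Afin : lebesgue_outer A \is a fin_num by rewrite ge0_fin_numE// lebesgue_outer_ge0.
have [_ [D [a [b [ab cov ->]]]] sA] := lb_ereal_inf_adherent d20 Afin.
rewrite -/(lebesgue_outer A) in sA.
have v0 k : D k -> 0 <= (volume (a k) (b k))%:E by rewrite lee_fin volume_ge0.
have soo : \sum_(k <oo | D k) (volume (a k) (b k))%:E < +oo.
  by apply: lt_trans sA _; rewrite lte_add_pinfty// ltry.
have [n _ /(_ n (leqnn n)) tail_lt] := nneseries_tail_cvg soo v0
  (nbhs_open_ereal_lt (f := fun=> delta / 2)%R d20).
exists n, D, a, b.
set U := \bigcup_(k in [set k | D k]) box (a k) (b k) in cov.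
pose W := \bigcup_(k in [set k | D k && (n <= k)%N]) box (a k) (b k).
have lW : lebesgue_outer W <= (delta / 2)%:E.
  apply: le_trans (ltW tail_lt); rewrite eseries_cond; apply: ereal_inf_lbound.
  by exists (fun k => D k && (n <= k)%N), a, b; split.
have lUA : lebesgue_outer (U `&` ~` A) <= (delta / 2)%:E.
  have UE : lebesgue_outer U = lebesgue_outer A + lebesgue_outer (U `&` ~` A).
    by have := mA U; rewrite [U `&` A]setIidr.
  rewrite -(@leeD2lE _ (lebesgue_outer A))// -UE; apply: le_trans (ltW sA).
  by apply: ereal_inf_lbound; exists D, a, b; split.
rewrite [delta in leRHS]splitr EFinD; apply: le_trans (leeD lW lUA).
apply: le_trans (lebesgue_outerU _ _); apply: le_lebesgue_outer => x.
move=> [[Ax nD]|[[k /= /andP[kn Dk] xk] nAx]].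
- left; have [k /= Dk xk] := cov _ Ax; exists k => //=; rewrite Dk leqNgt.
  by apply/negP => kn; apply: nD; exists k => //=; rewrite kn.
- by right; split => //; exists k.
Qed.

Lemma outer_exists_eq0 (I : finType) (C : countType) (F : C -> set (I -> R)) :
  (forall c, lebesgue_outer (F c) = 0) ->
  lebesgue_outer [set x | exists c, F c x] = 0.
Proof.
move=> F0; apply/eqP; rewrite eq_le lebesgue_outer_ge0 andbT.
pose G n := if unpickle n is Some c then F c else set0.
apply: (@le_trans _ _ (lebesgue_outer (\bigcup_n G n))).
  by apply: le_lebesgue_outer => x [c Fcx]; exists (pickle c) => //; rewrite /G pickleK.
apply: le_trans (lebesgue_outer_sigma_subadditive _) _.
rewrite eseries0// => n _ _; rewrite /G; case: unpickle => //.
Qed.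

Lemma outer_slice_eq0 (I : finType) (i : I) (e : R) :
  lebesgue_outer [set x : I -> R | (forall j, 0 <= x j <= 1)%R /\ x i = e] = 0.
Proof.
apply/eqP; rewrite eq_le lebesgue_outer_ge0 andbT.
pose a j := (if j == i then e else 0)%R; pose b j := (if j == i then e else 1)%R.
have ab j : (a j <= b j)%R by rewrite /a /b; case: eqP.
apply: (@le_trans _ _ (volume a b)%:E); last first.
  by rewrite /volume (bigD1 i)//= /a /b eqxx subrr mul0r.
apply: le_trans (outer_box ab); apply: le_lebesgue_outer => x [x01 xi] j.
by rewrite /a /b; case: eqP => [->|//]; rewrite xi lexx.
Qed.

(** Lebesgue's density points of [A] or of its complement, with the cells of [E j] in place of small
    balls. *)
Definition cell_density_point (I : finType) (E : nat -> seq R) (A : set (I -> R))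
    (x : I -> R) : Prop :=
  forall eps : R, (0 < eps)%R -> exists j0, forall j, (j0 <= j)%N ->
    lebesgue_outer (cell_box (E j) x `&` [set u | ~ (A u <-> A x)]) <=
      (eps * cell_volume (E j) x)%:E.

(* The points of [E j] are the endpoints of boxes approximating every [A c] up
   to measure 4^-(j+1): these unions of boxes are then unions of cells. *)
Lemma ae_cell_density_point (C : finType) (I : C -> finType)
    (A : forall c, set (I c -> R)) :
  (forall c, lebesgue_measurable (A c)) ->
  (forall c, lebesgue_outer (A c) < +oo) ->
  exists E : nat -> seq R, forall c, lebesgue_outer
    [set x | (forall i, 0 <= x i <= 1)%R /\ ~ cell_density_point E (A c) x] = 0.
Proof.
move=> mA Aoo.
(* With approximation up to [w j * w j], Markov's inequality at level [w j] discards a set of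
   measure at most [w j], which is summable. *)
pose w j : R := ((2 ^ j.+1)%:R)^-1%R.
have w0 j : (0 < w j)%R by rewrite invr_gt0 ltr0n expn_gt0.
have w1 j : (w j <= 1)%R by rewrite invf_le1 ?ltr0n ?expn_gt0// ler1n expn_gt0.
pose approx c j (p : nat * pred nat * (nat -> I c -> R) * (nat -> I c -> R)) :=
  lebesgue_outer (A c `+` \bigcup_(k in [set k | (k < p.1.1.1)%N && p.1.1.2 k])
    box (p.1.2 k) (p.2 k)) <= (w j * w j)%:E.
have ex_approx c j : exists p, approx c j p.
  have [n [D [a [b H]]]] :=
    approx_by_boxes (mA c) (Aoo c) (mulr_gt0 (w0 j) (w0 j)).
  by exists (n, D, a, b).
pose f c j := sval (cid (ex_approx c j)).
pose D c j := \bigcup_(k in [set k | (k < (f c j).1.1.1)%N && (f c j).1.1.2 k])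
  box ((f c j).1.2 k) ((f c j).2 k).
have lD c j : lebesgue_outer (A c `+` D c j) <= (w j * w j)%:E.
  exact: (svalP (cid (ex_approx c j))).
pose ends c j := flatten [seq [seq (f c j).1.2 k i | i <- enum (I c)] ++
  [seq (f c j).2 k i | i <- enum (I c)] | k <- iota 0 (f c j).1.1.1].
pose E j := flatten [seq ends c j | c <- enum C].
exists E => c.
have endE j k (i : I c) : (k < (f c j).1.1.1)%N ->
    ((f c j).1.2 k i \in E j) /\ ((f c j).2 k i \in E j).
  move=> kn.
  have H y : y \in ends c j -> y \in E j.
    by move=> yc; apply/flattenP; exists (ends c j) => //;
      apply/mapP; exists c; rewrite ?mem_enum.
  split; apply: H; apply/flattenP; (eexists;
    first by apply/mapP; exists k; [rewrite mem_iota|reflexivity]);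
    rewrite mem_cat; apply/orP; [left|right]; apply/mapP; exists i;
    by rewrite ?mem_enum.
have mS j : lebesgue_measurable (A c `+` D c j).
  have mD : lebesgue_measurable (D c j).
    apply: (@bigcup_measurable _ (caratheodory_type (@lebesgue_outer R (I c)))).
    by move=> k _; exact: box_measurable.
  by apply: caratheodory_measurable_setU; apply: caratheodory_measurable_setD;
    (exact: mA || exact: mD).
have ex_B j := markov_cells (E j) (mS j) (w0 j).
pose B j := sval (cid (ex_B j)).
have mB j : lebesgue_measurable (B j) by rewrite /B; case: cid => ? [].
have lB j : lebesgue_outer (B j) <= (w j)%:E.
  rewrite -(@lee_pmul2l _ (w j)%:E) ?lte_fin// -EFinM.
  by apply: le_trans (lD c j); rewrite /B; case: cid => ? [].
have BP j x : cell_box (E j) x x -> ~ B j x ->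
    lebesgue_outer ((A c `+` D c j) `&` cell_box (E j) x) <=
      (w j * cell_volume (E j) x)%:E.
  by rewrite /B; case: cid => Bj /= [_ _ BP]; exact: BP.
(* By Borel-Cantelli, almost every point lies in only finitely many [X j]. *)
pose X j := (A c `+` D c j) `|` B j.
have limX : lebesgue_outer (lim_sup_set X) = 0.
  apply: (@lim_sup_set_cvg0 _ (caratheodory_type (@lebesgue_outer R (I c))) R lambda).
    by move=> j; apply: caratheodory_measurable_setU; [exact: mS|exact: mB].
  apply: (@le_lt_trans _ _ (2 : R)%:E); last exact: ltry.
  apply: le_trans (epsilon_trick0 xpredT (ler0n R 2)).
  apply: lee_nneseries => [j _ _|j _]; first exact: lebesgue_outer_ge0.
  apply: le_trans (lebesgue_outerU _ _) _.
  apply: le_trans (leeD (lD c j) (lB j)) _; rewrite -EFinD lee_fin.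
  have : (w j * w j <= w j)%R by rewrite ler_piMr// ltW.
  by rewrite mulr_natl mulr2n lerD2r.
(* Points that may fail to be inside their own cell lie in countably many null slices; the default
   value of [nth] only repeats the slice at 0. *)
pose slices (q : I c * nat * nat) := [set x : I c -> R |
  (forall i, 0 <= x i <= 1)%R /\ x q.1.1 = nth 0%R [:: 0%R, 1%R & E q.1.2] q.2].
apply/eqP; rewrite eq_le lebesgue_outer_ge0 andbT.
apply: (@le_trans _ _ (lebesgue_outer ([set x | exists q, slices q x] `|` lim_sup_set X)));
  last first.
  apply: le_trans (lebesgue_outerU _ _) _.
  by rewrite limX adde0 outer_exists_eq0// => q; exact: outer_slice_eq0.
apply: le_lebesgue_outer => x [x01 ndx].
have [?|nslice] := pselect (exists q, slices q x); [by left|right].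
have xE i j : x i \notin [:: 0%R, 1%R & E j].
  apply/negP => xi; apply: nslice; exists (i, j, index (x i) [:: 0%R, 1%R & E j]).
  by split => //=; rewrite nth_index.
have xx j : cell_box (E j) x x.
  move=> i; have := xE i j; rewrite !inE !negb_or => /and3P[x0 x1 xE'].
  have /andP[x0' x1'] := x01 i.
  by apply: mem_cell => //; rewrite !lt_neqAle x0' x1' eq_sym x0 x1.
apply: contrapT => nlim; apply: ndx => eps eps0.
have [j0 j0P] : exists j0, forall j, (j0 <= j)%N -> ~ X j x.
  apply: contrapT => /forallNP H; apply: nlim => n _.
  have /existsNP[j] := H n; move=> /not_implyP[nj /contrapT Xj]; by exists j.
have [j1 j1P] : exists j1, forall j, (j1 <= j)%N -> (w j <= eps)%R.
  (* From here on, 1 / eps < j + 1 <= 2^(j+1). *)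
  exists (Num.truncn eps^-1)%R => j nj.
  rewrite invf_ple ?posrE ?ltr0n ?expn_gt0// (le_trans (ltW (truncnS_gt _)))//.
  by rewrite ler_nat (leq_trans _ (ltnW (ltn_expl j.+1 (ltnSn 1)))).
exists (maxn j0 j1) => j; rewrite geq_max => /andP[/j0P nX /j1P weps].
have {nX}[nS nB] : ~ (A c `+` D c j) x /\ ~ B j x.
  by split=> H; apply: nX; [left|right].
apply: (@le_trans _ _ (w j * cell_volume (E j) x)%:E); last first.
  rewrite lee_fin ler_wpM2r// volume_ge0// => i /=.
  exact/ltW/cell_left_lt_right.
apply: le_trans (BP j x (xx j) nB); apply: le_lebesgue_outer => u [xu nA].
split=> //.
(* Box endpoints belong to [E j], so [D c j] cannot separate two points of one cell. As [x] is
   outside the symmetric difference, [u] is inside it whenever [A c] separates them. *)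
have Dux : D c j u <-> D c j x.
  split=> -[k /andP[kn Dk] ku]; exists k; rewrite /= ?kn ?Dk//;
    by apply: box_cell_box ku => // i; have [] := endE j k i kn.
have AD : A c x <-> D c j x.
  split=> [Ax|Dx]; apply: contrapT => H; apply: nS; [left|right]; by split.
have [Au|nAu] := pselect (A c u); [left|right]; split => //.
- by move/Dux/AD => Ax; apply: nA.
- by apply: contrapT => nDu; apply: nA; split => // /AD/Dux.
Qed.

End density.

(** * Naming faces independently of the ambient vertex set *)

Section face_keys.
Context (R : realType).

(* The key of a face [A] of [x] records the labels of all faces of [A], the
   vertices being named by their own labels: off the diagonal, it forgets the
   ambient [V] but nothing else. *)
Definition face_key (V : finType) (x : r V -> R) (A : r V) :
    set (set R * R) * R :=
  ([set p | exists2 B : r V, sval B \subset sval A &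
     p = ([set x (r_singleton v) | v in [set` sval B]], x B)], x A).

Lemma r_image_singleton (U V : finType) (alpha : U -> V) (u : U) :
  r_image alpha (r_singleton u) = r_singleton (alpha u).
Proof. by apply: val_inj => /=; rewrite imset_set1. Qed.

(** Keys are built from labels alone. A perturbation chosen key by key therefore acts consistently
    on a point and on all its pullbacks. *)
Lemma face_key_pullback (U V : finType) (alpha : U -> V) (x : r V -> R) (A : r U) :
  face_key (pullback alpha x) A = face_key x (r_image alpha A).
Proof.
have imE (B : r U) :
    [set pullback alpha x (r_singleton v) | v in [set` sval B]] =
    [set x (r_singleton v) | v in [set` sval (r_image alpha B)]].
  rewrite /pullback; apply/seteqP; split => _ [v /= vB <-].
    by exists (alpha v); rewrite ?r_image_singleton//=; exact: imset_f.
  by case/imsetP: vB => u uB ->; exists u => //; rewrite r_image_singleton.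
congr pair; apply/seteqP; split => p [B BA ->].
  by exists (r_image alpha B); rewrite ?imE//; exact: imsetS.
(* The preimage of [B] is cut down to [A], since a non-injective [alpha] may send further vertices
   into [B]. *)
have ne : [set u in sval A | alpha u \in sval B]%SET != finset.set0.
  have /set0Pn[v vB] := svalP B.
  have /imsetP[u uA vE] := fintype.subsetP BA _ vB.
  by apply/set0Pn; exists u; rewrite inE uA -vE.
pose C : r U := exist (fun D : {set U} => D != finset.set0) _ ne.
exists C; first by apply/fintype.subsetP => u; rewrite inE => /andP[].
rewrite imE /pullback; suff -> : r_image alpha C = B by [].
apply: val_inj => /=; apply/setP => v; apply/imsetP/idP => [[u]|vB].
  by rewrite inE => /andP[_ uB] ->.
have /imsetP[u uA vE] := fintype.subsetP BA _ vB.
by exists u => //; rewrite inE uA -vE.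
Qed.

(** Each vertex of [A] leaves its label in the key through its singleton face, so distinct labels
    allow [A] to be recovered. *)
Lemma face_key_inj (V : finType) (x : r V -> R) :
  injective (x \o @r_singleton V) -> injective (face_key x).
Proof.
move=> xinj.
have sub A A' : face_key x A = face_key x A' -> sval A \subset sval A'.
  move=> eqA; apply/fintype.subsetP => u uA.
  pose p := ([set x (r_singleton v) | v in [set` sval (r_singleton u)]],
             x (r_singleton u)).
  have : (face_key x A).1 p by exists (r_singleton u) => //=; rewrite finset.sub1set.
  rewrite eqA => -[B BA [/seteqP[/(_ (x (r_singleton u))) H _] _]].
  have [|v vB /xinj <-] := H; first by exists u => //=; rewrite inE.
  exact: fintype.subsetP BA _ vB.
move=> A A' eqA; apply: val_inj => /=; apply/eqP.
by rewrite finset.eqEsubset !sub.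
Qed.

End face_keys.

(** * The filter of likely events *)

Section cell_filter.
Context (R : realType) (K : choiceType) (lab : K -> R) (E : nat -> seq R).
Local Open Scope ereal_scope.

(** The projection of the complement of [G]: outside it, the coordinates in [iota] alone guarantee
    [G]. *)
Let failing (J : finType) (iota : J -> K) (G : set (K -> R)) : set (J -> R) :=
  [set u | exists2 y : K -> R, y \o iota = u & ~ G y].

(* [G] belongs to the filter when it depends, up to probability tending to 0,
   on finitely many coordinates, sampled independently in the [j]-th cells of
   their labels. *)
Definition cell_filter : set_system (K -> R) :=
  [set G | exists (J : finType) (iota : J -> K), injective iota /\
    forall eps : R, (0 < eps)%R -> exists j0, forall j, (j0 <= j)%N ->
      lebesgue_outer (cell_box (E j) (lab \o iota) `&` failing iota G) <=
        (eps * cell_volume (E j) (lab \o iota))%:E].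

Lemma cell_volume_gt0 (I : finType) (F : seq R) (x : I -> R) :
  (0 < cell_volume F x)%R.
Proof. by apply: prodr_gt0 => i _; rewrite subr_gt0 cell_left_lt_right. Qed.

Instance cell_filter_filter : Filter cell_filter.
Proof.
split.
- exists void, (of_void K).
  split=> [[]//|eps eps0]; exists 0%N => j _.
  rewrite (_ : failing _ _ = set0) ?setI0 ?lebesgue_outer0.
    by rewrite lee_fin mulr_ge0// ltW// cell_volume_gt0.
  by apply/seteqP; split => // u [y _]; apply.
- move=> G1 G2 [J1 [iota1 [inj1 H1]]] [J2 [iota2 [inj2 H2]]].
  (* Both families of coordinates are merged, shared ones being identified; the two failure bounds
     are pulled back there and add up to [eps]. *)
  pose s := [seq iota1 i | i <- enum J1] ++ [seq iota2 i | i <- enum J2].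
  have s1 i : iota1 i \in s by rewrite mem_cat map_f// mem_enum.
  have s2 i : iota2 i \in s by rewrite mem_cat (map_f iota2) ?mem_enum ?orbT.
  pose kappa1 i : seq_sub s := SeqSub (s1 i).
  pose kappa2 i : seq_sub s := SeqSub (s2 i).
  have kinj1 : injective kappa1 by move=> i i' [] /inj1.
  have kinj2 : injective kappa2 by move=> i i' [] /inj2.
  exists (seq_sub s), val; split=> [|eps eps0]; first exact: val_inj.
  have e20 : (0 < eps / 2)%R by rewrite divr_gt0.
  have [j1 {}H1] := H1 _ e20; have [j2 {}H2] := H2 _ e20.
  exists (maxn j1 j2) => j; rewrite geq_max => /andP[/H1{}H1 /H2{}H2].
  have lh (t : seq_sub s) : (cell_left (E j) (lab (val t)) <
      cell_right (E j) (lab (val t)))%R by exact: cell_left_lt_right.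
  have := leeD (outer_pullback kinj1 lh H1) (outer_pullback kinj2 lh H2).
  rewrite -EFinD -mulrDl -splitr; apply: le_trans.
  apply: le_trans (lebesgue_outerU _ _); apply: le_lebesgue_outer.
  move=> u [ulh [y yu /not_andP[nG|nG]]]; [left|right]; (split; first exact: ulh).
  + split=> [i|]; first exact: (ulh (kappa1 i)).
    by exists y => //; rewrite -yu.
  + split=> [i|]; first exact: (ulh (kappa2 i)).
    by exists y => //; rewrite -yu.
- move=> G1 G2 G12 [J [iota [inj H]]]; exists J, iota; split=> // eps /H[j0 {}H].
  exists j0 => j /H; apply: le_trans; apply: le_lebesgue_outer.
  by move=> u [ulh [y yu nG2]]; split=> //; exists y => // /G12.
Qed.

(** If [set0] were in the filter, failure would fill a whole cell while taking at most half of its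
    volume. *)
Instance cell_filter_proper : ProperFilter cell_filter.
Proof.
apply: Build_ProperFilter => -[J [iota [inj H]]].
have [|j0 /(_ _ (leqnn _))] := H (1 / 2)%R; first by rewrite divr_gt0.
apply/negP; rewrite -ltNge.
apply: (@lt_le_trans _ _ (cell_volume (E j0) (lab \o iota))%:E).
  by rewrite lte_fin gtr_pMl ?cell_volume_gt0// div1r invf_lt1// ltr1n.
have -> : failing iota set0 = setT.
  apply/seteqP; split => // u _.
  exists (fun k => if [pick i | iota i == k] is Some i then u i else 0%R) => //.
  apply/funext => i /=; case: pickP => [i' /eqP/inj -> //|/(_ i)].
  by rewrite eqxx.
rewrite setIT; apply: volume_le_outer_open_box => i.
exact/ltW/cell_left_lt_right.
Qed.

End cell_filter.

(** * Structures induced by a point of the cube *)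

Section sampled_structures.
Context (R : realType) (L : language) (V : finType).

(** Requiring injectivity makes the structure canonical, so that weakness of [N] applies to it. *)
Definition sampled (N : euclidean_structure R L) (w : r V -> R) : structure L V :=
  Structure (fun P alpha => injective alpha /\ N P (pullback alpha w)).

Lemma cube_pullback (U : finType) (alpha : U -> V) (w : r V -> R) :
  cube R V w -> cube R U (pullback alpha w).
Proof. by move=> w01 A; exact: w01. Qed.

Lemma sampled_T_ind (N : euclidean_structure R L) (w : r V -> R) :
  cube R V w -> T_ind (sampled N w) N w.
Proof.
move=> w01; split=> // P _; split=> alpha [inj]; first by case.
move=> nN; split; first exact: cube_pullback.
by move=> Nw; apply: nN.
Qed.

(** Finitely many canonical structures live on [V], and each one that is not a model is induced with
    probability 0. *)
Lemma weak_on_outer_eq0 (T : universal_theory L) (N : euclidean_structure R L) :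
  weak_on T N ->
  lebesgue_outer [set w | cube R V w /\ ~ model_of (sampled N w) T] = 0%E.
Proof.
move=> weakN.
pose Q := {P : L & {ffun 'I_(arity P) -> V}}.
pose str (c : {ffun Q -> bool}) : structure L V := Structure
  (fun P t => injective t /\ c (Tagged (fun P => {ffun 'I_(arity P) -> V}) (finfun t))).
pose F (c : {ffun Q -> bool}) : set (r V -> R) :=
  if `[< model_of (str c) T >] then set0 else T_ind (str c) N.
apply/eqP; rewrite eq_le lebesgue_outer_ge0 andbT.
rewrite -(@outer_exists_eq0 R _ _ F); last first.
  move=> c; rewrite /F; case: asboolP => nmod; first exact: lebesgue_outer0.
  by apply: weakN => // P t [].
apply: le_lebesgue_outer => w [w01 nmod].
exists [ffun q : Q => `[< N (tag q) (pullback (tagged q) w) >]].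
set c := finfun _; suff cE : str c = sampled N w.
  by rewrite /F cE; case: asboolP => // _; exact: sampled_T_ind.
congr Structure; apply: functional_extensionality_dep => P.
apply/funext => t; apply/propext.
rewrite /c ffunE/=; have -> : (finfun t : 'I_(arity P) -> V) = t.
  by apply/funext => i; rewrite ffunE.
by split=> -[inj /asboolP].
Qed.

End sampled_structures.

(** Completeness of Lebesgue measure: [B] arises from [A] by removing one null set and adding
    another. *)
Lemma measurable_outer_setY_eq0 (R : realType) (I : finType) (A B : set (I -> R)) :
  lebesgue_measurable A -> lebesgue_outer (A `+` B) = 0%E -> lebesgue_measurable B.
Proof.
move=> mA AB0.
have mZ (Z : set (I -> R)) : Z `<=` A `+` B -> lebesgue_measurable Z.
  move=> ZAB; apply: le_caratheodory_measurable => X /=.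
  have -> : lebesgue_outer (X `&` Z) = 0%E.
    apply/eqP; rewrite eq_le lebesgue_outer_ge0 andbT -AB0.
    by apply: le_lebesgue_outer => x [_ /ZAB].
  by rewrite add0e; apply: le_lebesgue_outer => x [].
have -> : B = (A `\` (A `\` B)) `|` (B `\` A).
  apply/seteqP; split => [x Bx|x [[Ax nAB]|[]//]].
    by have [Ax|nAx] := pselect (A x); [left; split => // -[]|right].
  by apply: contrapT => nBx; apply: nAB.
apply: caratheodory_measurable_setU; last by apply: mZ => x; right.
by apply: caratheodory_measurable_setD => //; apply: mZ => x; left.
Qed.

(** * The ultrafilter limit *)

Section generic_sample.
Context (R : realType) (L : language) (T : universal_theory L)
  (N : euclidean_structure R L) (E : nat -> seq R).
Local Notation Key := (set (set R * R) * R)%type.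
Let cells : set_system (Key -> R) := cell_filter snd E.

(** This is the density condition read through the filter; off the diagonal, distinct faces of [z]
    get distinct coordinates of [y]. *)
Lemma cell_filter_density (P : L) (z : r 'I_(arity P) -> R) :
  injective (z \o @r_singleton _) -> cell_density_point E (N P) z ->
  cells [set y : Key -> R | N P (y \o face_key z) <-> N P z].
Proof.
move=> zinj dz; exists (r 'I_(arity P)), (face_key z).
split=> [|eps /dz[j0 H]]; first exact: face_key_inj.
exists j0 => j /H; apply: le_trans; apply: le_lebesgue_outer.
by move=> u [zu [y yu ny]]; split=> //=; rewrite -yu.
Qed.

(** Cells lie in the unit cube, so by [weak_on_outer_eq0] the failure has measure 0 in every
    cell. *)
Lemma cell_filter_model (V : finType) (x : r V -> R) :
  weak_on T N -> injective (x \o @r_singleton V) ->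
  cells [set y : Key -> R | model_of (sampled N (y \o face_key x)) T].
Proof.
move=> weakN xinj; exists (r V), (face_key x).
split=> [|eps eps0]; first exact: face_key_inj.
exists 0%N => j _; apply: (@le_trans _ _ 0%E); last first.
  by rewrite lee_fin mulr_ge0// ltW// cell_volume_gt0.
rewrite -(weak_on_outer_eq0 V weakN); apply: le_lebesgue_outer.
move=> u [xu [y yu nmod]]; split; last by rewrite -yu.
move=> A; have /andP[/ltW lu /ltW ur] := xu A.
by rewrite (le_trans (cell_left_ge0 _ _) lu) (le_trans ur (cell_right_le1 _ _)).
Qed.

Context (U : set_system (Key -> R)).

(** Keeping [N P] at density points confines the change to a null set; elsewhere [U] decides. *)
Definition limit_pon (P : L) : set (r 'I_(arity P) -> R) :=
  [set z | cube R _ z /\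
    ((cell_density_point E (N P) z /\ N P z) \/
     (~ cell_density_point E (N P) z /\ U [set y : Key -> R | N P (y \o face_key z)]))].

Arguments limit_pon : clear implicits.

Lemma limit_pon_setY (P : L) : N P `+` limit_pon P `<=`
  [set z | (forall A, 0 <= z A <= 1) /\ ~ cell_density_point E (N P) z].
Proof.
move=> z; have [dz|ndz] := pselect (cell_density_point E (N P) z).
  move=> [[Nz nL]|[[z01 [[_ Nz]|[]//]] nN]]; last by [].
  by exfalso; apply: nL; split; [exact: pon_sub Nz|left].
by move=> [[/pon_sub z01 _]|[[z01 _] _]].
Qed.

Hypotheses (ultraU : UltraFilter U) (cellsU : cells `<=` U).

(** At density points the event is already in the cell filter; elsewhere [U] contains the relevant
    set or its complement, and [limit_pon] follows that choice. *)
Lemma limit_pon_sample (P : L) (z : r 'I_(arity P) -> R) :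
  cube R _ z -> injective (z \o @r_singleton _) ->
  U [set y : Key -> R | N P (y \o face_key z) <-> limit_pon P z].
Proof.
move=> z01 zinj; have [dz|ndz] := pselect (cell_density_point E (N P) z).
  have NL : N P z <-> limit_pon P z.
    split=> [Nz|[_ [[]//|[]//]]]; by split => //; left.
  apply: filterS (cellsU (cell_filter_density zinj dz)) => y /= yN.
  exact: iff_trans yN NL.
have [US|UnS] := in_ultra_setVsetC [set y : Key -> R | N P (y \o face_key z)] ultraU.
  by apply: (filterS _ US) => y /= Ny; split => // _; split => //; right.
apply: (filterS _ UnS) => y /= nNy; split => // -[_ [[]//|[_ US]]].
by have [y' []] := filter_ex (filterI US UnS).
Qed.

(** For [U]-most [y], the perturbed point samples a model of [T] and agrees with [limit_pon] on the
    finitely many pullbacks of [x]. Off the diagonal a single such [y] then samples [M], which is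
    not a model. *)
Lemma limit_strong (N' : euclidean_structure R L) :
  (forall P, N' P = limit_pon P) -> weak_on T N -> strong_on T N'.
Proof.
move=> N'E weakN V M canM nmod x [x01 xM].
apply: contrapT => nD.
have xinj : injective (x \o @r_singleton V).
  move=> i j xij; apply: contrapT => /eqP ij; apply: nD; split=> //.
  by exists i, j.
have Uq : U [set y : Key -> R | forall q : {P : L & {ffun 'I_(arity P) -> V}},
    injective (tagged q) -> N (tag q) (pullback (tagged q) (y \o face_key x)) <->
      limit_pon (tag q) (pullback (tagged q) x)].
  apply: filter_forall => -[P alpha] /=.
  have [inj|ninj] := pselect (injective alpha); last by apply: filterE => y /ninj.
  have zinj : injective (pullback alpha x \o @r_singleton _).
    by move=> i j; rewrite /= /pullback !r_image_singleton => /xinj/inj.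
  have := limit_pon_sample (cube_pullback _ x01) zinj.
  apply: filterS => y /= yP _; rewrite -yP.
  (* Perturbation commutes with pullback because keys do not see the ambient vertex set. *)
  suff -> : pullback alpha (y \o face_key x) = y \o face_key (pullback alpha x) by [].
  by apply/funext => A; rewrite /= face_key_pullback.
have Umod := cellsU (cell_filter_model weakN xinj).
have [y [yq ymod]] := filter_ex (filterI Uq Umod).
apply: nmod; suff -> : M = sampled N (y \o face_key x) by [].
case: M canM xM => M canM xM; congr Structure.
apply: functional_extensionality_dep => P; apply/funext => t; apply/propext.
have [xin xout] := xM P I.
have tE : (finfun t : 'I_(arity P) -> V) = t by apply/funext => i; rewrite ffunE.
have := yq (Tagged (fun P => {ffun 'I_(arity P) -> V}) (finfun t)).
rewrite /= tE => yt; split=> [Mt|[inj /(yt inj) Lt]].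
  have inj := canM _ _ Mt; split=> //; apply/(yt inj).
  by rewrite -N'E; exact: (xin t).
apply: contrapT => nMt; have [//|_] := xout t.
by apply; rewrite N'E.
Qed.

End generic_sample.

Arguments limit_pon {R L} N E U P _.

Theorem theorem3p3 (R : realType) (L : language) (T : universal_theory L)
    (canT : canonical_theory T)
    (N : euclidean_structure R L) (weakN : weak_on T N) :
  exists N' : euclidean_structure R L,
    strong_on T N' /\ forall P : L, lambda (N P `+` N' P) = 0%E.
Proof.
have [|E aeE] := ae_cell_density_point (@pon_measurable R L N).
  move=> P; apply: (@le_lt_trans _ _ (volume (fun=> 0) (fun=> 1 : R))%:E);
    last exact: ltry.
  apply: le_trans (outer_box _); last by move=> i; exact: ler01.
  by apply: le_lebesgue_outer => x; exact: pon_sub.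
have [U [ultraU cellsU]] := ultraFilterLemma
  (cell_filter_proper (K := (set (set R * R) * R)%type) snd E).
have null P : lebesgue_outer (N P `+` limit_pon N E U P) = 0%E.
  apply/eqP; rewrite eq_le lebesgue_outer_ge0 andbT -(aeE P).
  exact/le_lebesgue_outer/limit_pon_setY.
pose N' := @EuclideanStructure R L (limit_pon N E U) (fun P z => @proj1 _ _)
  (fun P => measurable_outer_setY_eq0 (@pon_measurable _ _ N P) (null P)).
by exists N'; split=> //; exact: (limit_strong ultraU cellsU).
Qed.
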